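(* Let $1\le k\le n$ be integers and let $\Gamma$ and $\Gamma'$ be signed graphs of order $n$. (i) If $\Gamma$ and $\Gamma'$ are switching equivalent, then the $k$-token signed graphs $F_k(\Gamma)$ and $F_k(\Gamma')$ are switching equivalent. (ii) If $\Gamma$ and $\Gamma'$ are switching isomorphic, then $F_k(\Gamma)$ and $F_k(\Gamma')$ are switching isomorphic.
   Context: All graphs are finite and simple. A signed graph $\Gamma=(G,\sigma)$ is a graph $G=(V,E)$ with a signature $\sigma:E\to\{+1,-1\}$; its order is $|V|$. For $U\subseteq V$, the switching $\Gamma^U$ is the signed graph on $G$ obtained from $\Gamma$ by reversing the sign of every edge between $U$ and $V\setminus U$. Signed graphs $\Gamma,\Gamma'$ on the same underlying graph are switching equivalent if $\Gamma'=\Gamma^U$ for some $U\subseteq V$. An isomorphism of signed graphs is a graph isomorphism preserving edge signs. $\Gamma$ and $\Gamma'$ are switching isomorphic if $\Gamma'$ is isomorphic to $\Gamma^U$ for some $U\subseteq V$. The $k$-token signed graph $F_k(\Gamma)$ has as vertices the $k$-element subsets of $V$; two vertices $A,B$ are adjacent iff their symmetric difference is $A\,\Delta\, B=\{a,b\}$ with $a\in A$, $b\in B$, $ab\in E$, and the edge $AB$ then has sign $\sigma(ab)$. *)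

(* Defs.v *)
From mathcomp Require Import all_boot all_order all_algebra.

Set Implicit Arguments.
Unset Strict Implicit.
Unset Printing Implicit Defensive.

Import GRing.Theory.
Local Open Scope ring_scope.

Record simple_graph (V : finType) := SimpleGraph {
  adj : rel V;
  adj_sym : symmetric adj;
  adj_irr : irreflexive adj }.

(* The signature is a function on ordered pairs of which only the values on
   edges are meaningful: values off the edges are junk, they are unconstrained
   and ignored by all the notions below. *)
Record signed_graph (V : finType) := SignedGraph {
  ugraph :> simple_graph V;
  sign : V -> V -> int;
  sign_pm1 : forall x y, adj ugraph x y -> sign x y = 1 \/ sign x y = -1;
  sign_sym : forall x y, adj ugraph x y -> sign x y = sign y x }.

(* Equality of signed graphs on the vertex set V, up to the junk values. *)
Definition sg_eq (V : finType) (Gamma Gamma' : signed_graph V) : Prop :=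
  adj Gamma =2 adj Gamma' /\
  forall x y, adj Gamma x y -> sign Gamma x y = sign Gamma' x y.

Definition sg_isomorphic (V V' : finType)
    (Gamma : signed_graph V) (Gamma' : signed_graph V') : Prop :=
  exists f : V -> V',
    [/\ bijective f,
        forall x y, adj Gamma' (f x) (f y) = adj Gamma x y &
        forall x y, adj Gamma x y -> sign Gamma' (f x) (f y) = sign Gamma x y].

Section Switching.
Variables (V : finType) (Gamma : signed_graph V) (U : {set V}).

Definition switch_sign (x y : V) : int :=
  if (x \in U) (+) (y \in U) then - sign Gamma x y else sign Gamma x y.

Lemma switch_sign_pm1 x y :
  adj Gamma x y -> switch_sign x y = 1 \/ switch_sign x y = -1.
Proof.
rewrite /switch_sign => /sign_pm1[] ->; case: ifP => _; rewrite ?opprK; tauto.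
Qed.

Lemma switch_sign_sym x y :
  adj Gamma x y -> switch_sign x y = switch_sign y x.
Proof. by move=> xy; rewrite /switch_sign (sign_sym xy) addbC. Qed.

Definition switching : signed_graph V :=
  SignedGraph switch_sign_pm1 switch_sign_sym.

End Switching.

Definition switching_equivalent (V : finType) (Gamma Gamma' : signed_graph V) :
    Prop :=
  exists U : {set V}, sg_eq Gamma' (switching Gamma U).

Definition switching_isomorphic (V V' : finType)
    (Gamma : signed_graph V) (Gamma' : signed_graph V') : Prop :=
  exists U : {set V}, sg_isomorphic Gamma' (switching Gamma U).

Definition symdiff (V : finType) (A B : {set V}) : {set V} :=
  (A :\: B) :|: (B :\: A).

Definition ksubset (V : finType) (k : nat) : finType :=
  {A : {set V} | #|A| == k}.

Section Token.
Variables (V : finType) (k : nat) (Gamma : signed_graph V).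
Implicit Types (A B : ksubset V k) (p : V * V).

Definition token_move A B p : bool :=
  [&& p.1 \in val A, p.2 \in val B,
      symdiff (val A) (val B) == [set p.1; p.2] & adj Gamma p.1 p.2].

Definition token_adj A B : bool := [exists p, token_move A B p].

(* The pair (a, b) with a \in A, b \in B and A Delta B = {a, b} is unique when
   A and B are adjacent, see token_signE. *)
Definition token_sign A B : int :=
  if [pick p | token_move A B p] is Some p then sign Gamma p.1 p.2 else 1.

Lemma token_move_sym A B a b :
  token_move A B (a, b) -> token_move B A (b, a).
Proof.
case/and4P=> /= aA bB /eqP AB ab; apply/and4P; split=> //=; last first.
  by rewrite adj_sym.
by rewrite /symdiff setUC -/(symdiff _ _) AB setUC.
Qed.

Lemma token_move_notin A B a b :
  token_move A B (a, b) -> (a \notin val B) /\ (b \notin val A).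
Proof.
case/and4P=> /= aA bB /eqP AB _.
have := set21 a b; have := set22 a b; rewrite -AB !inE aA bB /=.
by rewrite ?andbT ?andbF ?orbF => -> ->.
Qed.

Lemma token_move_uniq A B p q :
  token_move A B p -> token_move A B q -> p = q.
Proof.
case: p q => [a b] [c d] mp mq.
have [aB bA] := token_move_notin mp; have [cB dA] := token_move_notin mq.
case/and4P: mp => /= aA bB /eqP AB _; case/and4P: mq => /= cA dB /eqP AB' _.
have: a \in [set c; d] by rewrite -AB' AB set21.
have: b \in [set c; d] by rewrite -AB' AB set22.
rewrite !inE => /orP[/eqP bc|/eqP bd]; first by rewrite bc cA in bA.
by case/orP=> [/eqP ac|/eqP ad]; [rewrite ac bd | rewrite ad dB in aB].
Qed.

Lemma token_signE A B a b :
  token_move A B (a, b) -> token_sign A B = sign Gamma a b.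
Proof.
rewrite /token_sign => m; case: pickP => [p mp|/(_ (a, b))]; last by rewrite m.
by rewrite (token_move_uniq mp m).
Qed.

Lemma token_adj_sym : symmetric token_adj.
Proof.
by move=> A B; apply/existsP/existsP=> -[[a b] /token_move_sym m];
  exists (b, a).
Qed.

Lemma token_adj_irr : irreflexive token_adj.
Proof.
move=> A; apply/existsP=> -[[a b] m].
have [aA _] := token_move_notin m; case/and4P: m => /=.
by rewrite (negbTE aA).
Qed.

Lemma token_sign_pm1 A B :
  token_adj A B -> token_sign A B = 1 \/ token_sign A B = -1.
Proof.
case/existsP=> -[a b] m; rewrite (token_signE m).
by case/and4P: m => _ _ _ /sign_pm1.
Qed.

Lemma token_sign_sym A B :
  token_adj A B -> token_sign A B = token_sign B A.
Proof.
case/existsP=> -[a b] m; rewrite (token_signE m).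
rewrite (token_signE (token_move_sym m)).
by case/and4P: m => _ _ _ /sign_sym.
Qed.

Definition token_graph : signed_graph (ksubset V k) :=
  @SignedGraph _ (SimpleGraph token_adj_sym token_adj_irr) token_sign
    token_sign_pm1 token_sign_sym.

End Token.

Arguments token_graph {V} k Gamma.

(* Main.v *)
Require Import Defs.
From mathcomp Require Import all_boot all_order all_algebra.

(** Switch the token graph at the set of those k-subsets that meet [U] in an
    odd number of vertices.  Moving one token along an edge [ab] changes the
    parity of the number of tokens in [U] exactly when [ab] joins [U] to its
    complement, so this switching of [F_k Gamma] is [F_k] of the switching of
    [Gamma] at [U].  Moreover [F_k] maps isomorphisms to isomorphisms. *)

Set Implicit Arguments.
Unset Strict Implicit.
Unset Printing Implicit Defensive.

(** Both sides are the set [val A :&: val B] of tokens that stay in place. *)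
Lemma token_move_setD1 (V : finType) (k : nat) (Gamma : signed_graph V)
    (A B : ksubset V k) (a b : V) :
  token_move Gamma A B (a, b) -> val A :\ a = val B :\ b.
Proof.
move=> m; have [aB bA] := token_move_notin m; case/and4P: m => /= aA bB AB _.
apply/setP=> x; have /setP/(_ x) := eqP AB; rewrite !inE.
have [->|_] := eqVneq x a; first by rewrite (negbTE aB) !andbF.
have [->|_] := eqVneq x b; first by rewrite (negbTE bA) !andbF.
by case: (x \in val A); case: (x \in val B).
Qed.

(** The fixed tokens contribute equally to both counts and cancel modulo 2, leaving the
    contributions of [a] and [b]. *)
Lemma token_move_parity (V : finType) (k : nat) (Gamma : signed_graph V)
    (A B : ksubset V k) (a b : V) (U : {set V}) :
  token_move Gamma A B (a, b) ->
  odd #|val A :&: U| (+) odd #|val B :&: U| = (a \in U) (+) (b \in U).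
Proof.
move=> m; have AB := token_move_setD1 m; case/and4P: m => /= aA bB _ _.
rewrite (cardsD1 a (val A :&: U)) (cardsD1 b (val B :&: U)) !inE aA bB /=.
rewrite -!setIDAC AB !oddD !oddb.
by case: (a \in U); case: (b \in U); case: (odd _).
Qed.

(** The sign of a token edge is read at an edge of [Gamma], so junk values off the edges never
    enter. *)
Lemma token_graph_sg_eq (V : finType) (k : nat) (Gamma Gamma' : signed_graph V) :
  sg_eq Gamma Gamma' -> sg_eq (token_graph k Gamma) (token_graph k Gamma').
Proof.
case=> eqadj eqsign.
have eqmove A B p : @token_move V k Gamma A B p = token_move Gamma' A B p.
  by rewrite /token_move eqadj.
split=> [A B|A B /existsP[[a b] m]] /=; first exact: eq_existsb.
rewrite (token_signE m); move: (m); rewrite eqmove => /token_signE ->.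
by case/and4P: m => _ _ _ /eqsign.
Qed.

Lemma token_graph_switching (V : finType) (k : nat) (Gamma : signed_graph V)
    (U : {set V}) :
  sg_eq (token_graph k (switching Gamma U))
    (switching (token_graph k Gamma)
       [set A : ksubset V k | odd #|val A :&: U|]).
Proof.
split=> // A B /existsP[[a b] m] /=.
(* Switching keeps the underlying graph, so the moves agree by conversion. *)
have m' : token_move Gamma A B (a, b) by [].
by rewrite (token_signE m) /= /switch_sign !inE (token_move_parity U m')
  /= (token_signE m').
Qed.

Section ImsetKsubset.
Variables (V V' : finType) (k : nat) (f : V -> V') (f_inj : injective f).

Fact imset_ksubset_proof (A : ksubset V k) : #|f @: val A| == k.
Proof. by rewrite card_imset // (valP A). Qed.

Definition imset_ksubset (A : ksubset V k) : ksubset V' k :=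
  Sub (f @: val A) (imset_ksubset_proof A).

(** At a point [f x], injectivity reduces membership to [x]; a point outside the range of [f] lies
    in neither side. *)
Lemma symdiff_imset (A B : {set V}) :
  symdiff (f @: A) (f @: B) = f @: symdiff A B.
Proof.
apply/setP=> y; have [/codomP[x ->]|yf] := boolP (y \in codom f).
  by rewrite !inE !mem_imset // !inE.
have yfN (C : {set V}) : (y \in f @: C) = false.
  by apply/imsetP=> -[x _ yx]; rewrite yx codom_f in yf.
by rewrite !inE !yfN.
Qed.

End ImsetKsubset.

Lemma imset_ksubsetK (V V' : finType) (k : nat) (f : V -> V') (g : V' -> V)
    (f_inj : injective f) (g_inj : injective g) :
  cancel f g ->
  cancel (@imset_ksubset V V' k f f_inj) (imset_ksubset g_inj).
Proof.
move=> fK A; apply: val_inj; rewrite /= -imset_comp.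
by rewrite (eq_imset _ (g := id)) ?imset_id.
Qed.

Lemma token_graph_isomorphic (V V' : finType) (k : nat)
    (Gamma : signed_graph V) (Gamma' : signed_graph V') :
  sg_isomorphic Gamma Gamma' ->
  sg_isomorphic (token_graph k Gamma) (token_graph k Gamma').
Proof.
case=> f [f_bij fadj fsign]; have f_inj := bij_inj f_bij.
have fmove (A B : ksubset V k) a b :
    token_move Gamma' (imset_ksubset f_inj A) (imset_ksubset f_inj B) (f a, f b)
    = token_move Gamma A B (a, b).
  rewrite /token_move /= !mem_imset // fadj symdiff_imset //.
  (* Writing the pair as the image of [[set a; b]] lets injectivity of the image map cancel [f]. *)
  by rewrite -imset_set1 -[[set f b]]imset_set1 -imsetU (inj_eq (imset_inj f_inj)).
exists (imset_ksubset f_inj); split=> [|A B|A B /existsP[[a b] m]] /=.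
- have [g fK gK] := f_bij.
  by exists (imset_ksubset (can_inj gK)); apply: imset_ksubsetK.
- apply/existsP/existsP=> [[[c d]]|[[a b] m]]; last first.
    by exists (f a, f b); rewrite fmove.
  (* Surjectivity of [f] is needed here: the ends of a move in [Gamma'] are pulled back along
     [g]. *)
  have [g _ gK] := f_bij.
  by rewrite -(gK c) -(gK d) fmove; exists (g c, g d).
rewrite (token_signE m); move: (m); rewrite -fmove => /token_signE ->.
by case/and4P: m => _ _ _ /fsign.
Qed.

Lemma sg_eq_trans (V : finType) (G1 G2 G3 : signed_graph V) :
  sg_eq G1 G2 -> sg_eq G2 G3 -> sg_eq G1 G3.
Proof.
case=> [a12 s12] [a23 s23]; split=> [x y|x y xy]; first by rewrite a12.
by rewrite s12 // s23 // -a12.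
Qed.

(** As [sg_eq] is weaker than equality, replacing the target of an isomorphism takes an argument:
    the same map works. *)
Lemma sg_isomorphic_eq_trans (V V' : finType) (G1 : signed_graph V)
    (G2 G3 : signed_graph V') :
  sg_isomorphic G1 G2 -> sg_eq G2 G3 -> sg_isomorphic G1 G3.
Proof.
case=> f [f_bij fadj fsign] [a23 s23]; exists f.
split=> // [x y|x y xy]; first by rewrite -a23.
by rewrite -s23 ?fsign ?fadj.
Qed.

Theorem theorem3p3 (n k : nat) (hk : (1 <= k <= n)%N) :
  (forall (V : finType) (Gamma Gamma' : signed_graph V),
      #|V| = n ->
      switching_equivalent Gamma Gamma' ->
      switching_equivalent (token_graph k Gamma) (token_graph k Gamma')) /\
  (forall (V V' : finType) (Gamma : signed_graph V) (Gamma' : signed_graph V'),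
      #|V| = n -> #|V'| = n ->
      switching_isomorphic Gamma Gamma' ->
      switching_isomorphic (token_graph k Gamma) (token_graph k Gamma')).
Proof.
split=> [V Gamma Gamma' _ [U eqU]|V V' Gamma Gamma' _ _ [U isoU]];
    exists [set A : ksubset V k | odd #|val A :&: U|].
  exact: sg_eq_trans (token_graph_sg_eq k eqU) (token_graph_switching k Gamma U).
exact: sg_isomorphic_eq_trans (token_graph_isomorphic k isoU)
  (token_graph_switching k Gamma U).
Qed.
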